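(* Let $H$ be a near-star with $k$ vertices and $\ell$ leaves. If $\frac{k+1}{2}\leq \ell\leq k-3$, then $H\not\succcurlyeq P_k$, where $P_k$ is the path with $k$ vertices.
   Context: All graphs are finite, simple and undirected; $v(\cdot)$, $e(\cdot)$ denote numbers of vertices and edges. $t(H,G)=\hom(H,G)/v(G)^{v(H)}$, where $\hom(H,G)$ is the number of graph homomorphisms from $H$ to $G$. For non-empty graphs (graphs with at least one edge) $H,T$, $H\succcurlyeq T$ means $t(H,G)^{e(T)}\geq t(T,G)^{e(H)}$ for every graph $G$. A tree is a near-star if it can be obtained from a star by subdividing edges in such a way that each edge of the star is subdivided at most once. *)

(* Defs.v *)
From HB Require Import structures.
From mathcomp Require Import all_boot all_order all_algebra.
Set Implicit Arguments.
Unset Strict Implicit.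
Unset Printing Implicit Defensive.

Record sgraph := SGraph {
  vert :> finType;
  adj : rel vert;
  adj_sym : symmetric adj;
  adj_irrefl : irreflexive adj }.

Definition edges (G : sgraph) : {set {set G}} :=
  [set [set p.1; p.2] | p in [set p : G * G | adj p.1 p.2]].

Definition v (G : sgraph) : nat := #|G|.
Definition e (G : sgraph) : nat := #|edges G|.

Definition degree (G : sgraph) (x : G) : nat := #|[set y | adj x y]|.
Definition num_leaves (G : sgraph) : nat := #|[set x : G | degree x == 1]|.

Definition isomorphic (G H : sgraph) : Prop :=
  exists2 f : G -> H, bijective f & forall x y, adj (f x) (f y) = adj x y.

Definition is_hom (H G : sgraph) (f : {ffun H -> G}) : bool :=
  [forall x, forall y, adj x y ==> adj (f x) (f y)].

Definition hom (H G : sgraph) : nat := #|[set f : {ffun H -> G} | is_hom f]|.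

Definition t (H G : sgraph) : rat := ((hom H G)%:R / (v G)%:R ^+ v H)%R.

(* The relation "H succeq T", meant for H and T with at least one edge.  The
   densities are only defined when G has a vertex. *)
Definition dominates (H T : sgraph) : Prop :=
  forall G : sgraph, 0 < v G -> (t T G ^+ e H <= t H G ^+ e T)%R.

Definition path_adj (k : nat) : rel 'I_k :=
  fun i j => (i.+1 == j) || (j.+1 == i).

Lemma path_adj_sym k : symmetric (@path_adj k).
Proof. by move=> i j; rewrite /path_adj orbC. Qed.

Lemma path_adj_irrefl k : irreflexive (@path_adj k).
Proof. by move=> i; rewrite /path_adj orbb eqn_leq ltnn. Qed.

Definition path_graph (k : nat) : sgraph :=
  SGraph (@path_adj_sym k) (@path_adj_irrefl k).

(* The star with m edges: the centre is None. *)
Definition star_adj (m : nat) : rel (option 'I_m) :=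
  fun x y => isSome x (+) isSome y.

Lemma star_adj_sym m : symmetric (@star_adj m).
Proof. by move=> x y; rewrite /star_adj addbC. Qed.

Lemma star_adj_irrefl m : irreflexive (@star_adj m).
Proof. by move=> x; rewrite /star_adj addbb. Qed.

Definition star (m : nat) : sgraph :=
  SGraph (@star_adj_sym m) (@star_adj_irrefl m).

(* Subdivide once each edge of G lying in F: the new vertices are the elements
   of F, and each is joined to its two endpoints, which are no longer adjacent
   to each other. *)
Definition subdiv_adj (G : sgraph) (F : {set {set G}}) :
    rel (G + {E : {set G} | E \in F}) :=
  fun a b => match a, b with
  | inl x, inl y => adj x y && ([set x; y] \notin F)
  | inl x, inr E => x \in val E
  | inr E, inl x => x \in val E
  | inr _, inr _ => false
  end.

Lemma subdiv_adj_sym (G : sgraph) (F : {set {set G}}) :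
  symmetric (@subdiv_adj G F).
Proof. by move=> [x|E] [y|E'] //=; rewrite adj_sym setUC. Qed.

Lemma subdiv_adj_irrefl (G : sgraph) (F : {set {set G}}) :
  irreflexive (@subdiv_adj G F).
Proof. by move=> [x|E] //=; rewrite adj_irrefl. Qed.

Definition subdivision (G : sgraph) (F : {set {set G}}) : sgraph :=
  SGraph (@subdiv_adj_sym G F) (@subdiv_adj_irrefl G F).

(* Every subdivision of a star is a tree, so being a tree is not required
   separately. *)
Definition near_star (H : sgraph) : Prop :=
  exists (m : nat) (F : {set {set star m}}),
    F \subset edges (star m) /\ isomorphic H (subdivision F).

(* Main.v *)
Require Import Defs.
From mathcomp Require Import all_boot all_order all_algebra.
From mathcomp Require Import zify.
Set Implicit Arguments.
Unset Strict Implicit.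
Unset Printing Implicit Defensive.

(** Let [H] be the star with [m] edges of which [s] are subdivided, so that
[k = m + s + 1], [2 <= s <= m - 2], and [H] and [P_k] both have [k - 1] edges.
It is enough to find [G] with [hom H G < hom P_k G].  Write [d x] and [w x] for
the numbers of walks of lengths 1 and 2 from [x]; then [hom H G] is the sum of
[d x ^ (m - s) * w x ^ s], and [hom P_k G] is the number of walks of length
[k - 1].

Take [G] with vertex classes [A - B - C - D], and with edges inside [D] as
well.  All degrees between classes are powers of a large [n]: a vertex of [A]
has one neighbour in [B], and, with [M = m - 3], [p = 2M^2 + 4M],
[u = 2M^2 + 2M] and [r = 2M^2 + 1], the exponents are
[B -> A : p], [B -> C : p - r], [C -> B : r], [C -> D : r], [D -> C : u],
[D -> D : u], with [n ^ u] vertices in [D].  The walks following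
[A B C D ... D C B A] number at least [n ^ ((k - 4) u + 2 r + 2 p)].  Compared
with this exponent, that of the contribution of [x] to [hom H G] is smaller by
[2 (r + p - 2 u) = 2] for [x] in [D], by [M (2 (M - s) + 3) >= M] for [x] in
[C], by [1 + (s - 2) u] for [x] in [B], and by more for [x] in [A]. *)

(** * Edges, isomorphism invariants, and edge counts of rooted trees *)

Lemma mem_edges (G : sgraph) (x y : G) : ([set x; y] \in edges G) = adj x y.
Proof.
apply/imsetP/idP => [[[a b]]|xy]; last by exists (x, y); rewrite ?inE.
rewrite inE /= => ab eq_xy.
have nab : a != b by apply: contraTneq ab => ->; rewrite adj_irrefl.
have : a \in [set x; y] by rewrite eq_xy set21.
have : b \in [set x; y] by rewrite eq_xy set22.
rewrite !inE => /orP[]/eqP b_xy /orP[]/eqP a_xy; move: nab ab.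
all: by rewrite a_xy b_xy ?eqxx // adj_sym.
Qed.

Lemma isomorphic_v (G H : sgraph) : isomorphic G H -> v G = v H.
Proof. by case=> f bij_f _; apply: bij_eq_card bij_f. Qed.

Lemma isomorphic_e (G H : sgraph) : isomorphic G H -> e G = e H.
Proof.
case=> f bij_f adj_f; have inj_f := bij_inj bij_f; have [g fK gK] := bij_f.
rewrite /e -(card_imset (mem (edges G)) (imset_inj inj_f)); apply: eq_card => E.
apply/imsetP/imsetP => [[E' /imsetP[[x y]]]|[[x y]]]; rewrite inE /=.
  move=> xy -> ->; exists (f x, f y); first by rewrite inE adj_f.
  by rewrite imsetU !imset_set1.
move=> xy ->; exists [set g x; g y].
  by rewrite mem_edges -adj_f !gK.
by rewrite imsetU !imset_set1 !gK.
Qed.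

Lemma isomorphic_degree (G H : sgraph) (f : G -> H) :
    bijective f -> (forall x y, adj (f x) (f y) = adj x y) ->
  forall x, degree (f x) = degree x.
Proof.
move=> bij_f adj_f x; have [g fK gK] := bij_f.
rewrite /degree -(card_imset (mem [set y | adj x y]) (bij_inj bij_f)).
apply: eq_card => y; rewrite inE; apply/idP/imsetP => [xy|[z]].
  by exists (g y); rewrite ?gK // inE -adj_f gK.
by rewrite inE => xz ->; rewrite adj_f.
Qed.

Lemma isomorphic_num_leaves (G H : sgraph) :
  isomorphic G H -> num_leaves G = num_leaves H.
Proof.
case=> f bij_f adj_f; have [g fK gK] := bij_f.
rewrite /num_leaves.
rewrite -(card_imset (mem [set x : G | degree x == 1]) (bij_inj bij_f)).
apply: eq_card => y; rewrite inE; apply/imsetP/idP => [[x]|y1].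
  by rewrite inE => x1 ->; rewrite (isomorphic_degree bij_f adj_f).
by exists (g y); rewrite ?gK // inE -(isomorphic_degree bij_f adj_f) gK.
Qed.

Lemma isomorphic_hom_le (H H' G : sgraph) :
  isomorphic H H' -> Defs.hom H G <= Defs.hom H' G.
Proof.
case=> f bij_f adj_f; have [g fK gK] := bij_f.
pose F (h : {ffun H -> G}) := [ffun y => h (g y)].
have F_inj : injective F.
  move=> h h' /ffunP eq_h; apply/ffunP => x.
  by have := eq_h (f x); rewrite !ffunE fK.
rewrite /Defs.hom -(card_imset (mem [set h : {ffun H -> G} | is_hom h]) F_inj).
apply/subset_leq_card/subsetP => _ /imsetP[h + ->]; rewrite !inE.
move=> /forallP hom_h; apply/forallP => x; apply/forallP => y;
  apply/implyP => xy.
rewrite !ffunE; move/forallP: (hom_h (g x)) => /(_ (g y))/implyP; apply.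
by rewrite -adj_f !gK.
Qed.

(** Each edge is charged to its child end. If distinct [x] and [y] gave the same edge, each would be
    the parent of the other, against the strict decrease of [depth]. *)
Lemma e_rooted_tree (G : sgraph) (r : G) (parent : G -> G) (depth : G -> nat) :
    (forall x, x != r -> depth (parent x) < depth x) ->
    (forall x y, adj x y =
       (x != r) && (y == parent x) || (y != r) && (x == parent y)) ->
  e G = (v G).-1.
Proof.
move=> depthP adjP.
rewrite /e; have -> : edges G = [set [set x; parent x] | x in [set~ r]].
  apply/setP=> E; apply/imsetP/imsetP => [[[x y]]|[x]]; rewrite !inE /=.
    rewrite adjP => /orP[]/andP[nr /eqP->] ->; first by exists x; rewrite ?inE.
    by exists y; rewrite ?inE // setUC.
  by move=> nr ->; exists (x, parent x); rewrite // inE adjP nr eqxx.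
have -> : (v G).-1 = #|[set~ r]|.
  by rewrite cardsC1.
apply: card_in_imset => x y; rewrite !inE => nx ny eq_xy.
have : x \in [set y; parent y] by rewrite -eq_xy set21.
have : y \in [set x; parent x] by rewrite eq_xy set21.
rewrite !inE => /pred2P[//|yx] /pred2P[//|xy].
have := depthP _ ny; have := depthP _ nx.
by rewrite -xy -yx => /ltn_trans lt_xy /lt_xy; rewrite ltnn.
Qed.

Lemma e_path_graph k : e (path_graph k.+1) = k.
Proof.
suff -> : e (path_graph k.+1) = (v (path_graph k.+1)).-1 by rewrite /v card_ord.
apply: (@e_rooted_tree (path_graph k.+1) (ord0 : path_graph k.+1)
  (fun i => inord (i : nat).-1) (fun i => i : nat)).
  move=> i; rewrite -(inj_eq val_inj) /= => i0.
  by rewrite inordK; case: (nat_of_ord i) (ltn_ord i) i0 => // a ltak _;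
    apply: ltnW.
move=> i j; rewrite /adj /= /path_adj orbC.
have H (a b : 'I_k.+1) : (b.+1 == a) = (a != ord0) && (b == inord a.-1).
  rewrite -!(inj_eq val_inj) /=; case: a => [[|a] lta] //=.
  by rewrite inordK ?eqSS //; apply: ltnW.
by rewrite !H.
Qed.

(** * Walks and homomorphisms from paths *)

Fixpoint walks (G : sgraph) (n : nat) (x : G) : nat :=
  if n is n'.+1 then \sum_(y | adj x y) walks n' y else 1.

(** Splitting off the first entry matches the recursion of [walks], and later adds the choice of the
    starting vertex. *)
Lemma card_tuple_cons (T : finType) n (P : pred (seq T)) :
  #|[set p : n.+1.-tuple T | P p]| =
  \sum_x #|[set p : n.-tuple T | P (x :: p)]|.
Proof.
rewrite -sum1_card (partition_big (fun p : n.+1.-tuple T => thead p) xpredT) //.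
apply: eq_bigr => x _; rewrite -sum1_card.
rewrite (reindex_onto (fun p : n.-tuple T => [tuple of x :: p])
  (fun p => [tuple of behead p])) /=.
  apply: eq_bigl => p; rewrite !inE theadE eqxx /= andbT.
  have <- : p = [tuple of behead [tuple of x :: p]] by apply: val_inj.
  by rewrite eqxx andbT.
by move=> p /andP[_ /eqP <-]; rewrite [RHS]tuple_eta; apply: val_inj.
Qed.

Lemma walks_path_tuples (G : sgraph) n (x : G) :
  walks n x = #|[set p : n.-tuple G | path (@adj G) x p]|.
Proof.
elim: n x => [|n IH] x.
  by rewrite (eq_card1 (x := [tuple])) // => p; rewrite !inE tuple0 eqxx.
rewrite card_tuple_cons /= big_mkcond; apply: eq_bigr => y _; rewrite IH.
by case: ifP => _ //; apply/esym/eqP; rewrite cards_eq0; apply/eqP/setP=> p;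
  rewrite !inE.
Qed.

Lemma sum_walks_le_hom_path (G : sgraph) n :
  \sum_(x : G) walks n x <= Defs.hom (path_graph n.+1) G.
Proof.
pose F (t : n.+1.-tuple G) : {ffun path_graph n.+1 -> G} :=
  [ffun i => tnth t i].
have F_inj : injective F.
  move=> s t /ffunP eq_st; apply: eq_from_tnth => i.
  by have := eq_st i; rewrite !ffunE.
under eq_bigr do rewrite walks_path_tuples.
rewrite -(card_tuple_cons n (sorted (@adj G))).
rewrite /Defs.hom -(card_imset _ F_inj);
  apply/subset_leq_card/subsetP => _ /imsetP[t + ->].
rewrite !inE; case/tupleP: t => x p /= /(pathP x) walk_t.
have step (i j : 'I_n.+1) :
    i.+1 = j -> adj (tnth [tuple of x :: p] i) (tnth [tuple of x :: p] j).
  move=> ij; rewrite !(tnth_nth x) -ij; apply: walk_t.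
  by rewrite size_tuple -ltnS ij.
apply/forallP=> i; apply/forallP=> j; apply/implyP; rewrite !ffunE.
by case/orP=> /eqP /step //; rewrite adj_sym.
Qed.

(** * Subdivided stars: homomorphisms, edges and leaves *)

Definition star_edge m (i : 'I_m) : {set star m} := [set None; Some i].

Lemma edges_star m : edges (star m) = [set star_edge i | i in 'I_m].
Proof.
apply/setP=> E; apply/imsetP/imsetP => [[[[i|] [j|]]]|[i _ ->]];
  rewrite ?inE //=.
- by move=> _ ->; exists i; rewrite // /star_edge setUC.
- by move=> _ ->; exists j.
by exists (None, Some i); rewrite ?inE.
Qed.

Lemma star_edge_inj m : injective (@star_edge m).
Proof.
by move=> i j /setP/(_ (Some i)); rewrite !inE eqxx => /esym/eqP[].
Qed.

Section StarSubdivision.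

Variables (m : nat) (F : {set {set star m}}).
Hypothesis F_edges : F \subset edges (star m).

Let S := subdivision F.
Let subdivided := [set i : 'I_m | star_edge i \in F].

Lemma subdivision_vertexP (x : S) :
  [\/ x = inl None, exists i, x = inl (Some i) |
      exists i (iF : star_edge i \in F), x = inr (Sub (star_edge i) iF)].
Proof.
case: x => [[i|]|[E EF]]; first by constructor 2; exists i.
  by constructor 1.
constructor 3; have := subsetP F_edges _ EF;
  rewrite edges_star => /imsetP[i _ def_E].
by subst E; exists i, EF.
Qed.

Lemma card_subdivided : #|subdivided| = #|F|.
Proof.
rewrite -(card_imset _ (@star_edge_inj m)); apply: eq_card => E.
apply/imsetP/idP => [[i + ->]|EF]; first by rewrite inE.
have := subsetP F_edges _ EF; rewrite edges_star => /imsetP[i _ def_E].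
by exists i; rewrite // inE -def_E.
Qed.

Lemma v_subdivision : v S = (m + #|F|).+1.
Proof.
by rewrite /v card_sum card_option card_ord card_sig addSn; congr (_ + _).+1;
  apply: eq_card.
Qed.

(** A homomorphism is determined by the image [x] of the centre and the images of the legs. Each leg
    is then a walk from [x], of length 2 if subdivided and of length 1 otherwise. *)
Lemma hom_subdivision_le (G : sgraph) :
  Defs.hom S G <= \sum_(x : G) walks 1 x ^ (m - #|F|) * walks 2 x ^ #|F|.
Proof.
(* Every leg is encoded as a pair (neighbour of the centre, end of the leg). An unsubdivided leg
   repeats its end, so that both kinds live in [G * G]. *)
pose D x := [set yz : G * G | adj x yz.1 & yz.2 == yz.1].
pose W x := [set yz : G * G | adj x yz.1 & adj yz.1 yz.2].
pose legs x := family (fun i => mem (if i \in subdivided then W x else D x)).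
have cardD x : #|D x| = walks 1 x.
  rewrite -sum1_card /= [RHS](eq_bigr (fun y => \sum_(z | z == y) 1)).
    by rewrite pair_big_dep /=; apply: eq_bigl => -[y z]; rewrite inE.
  by move=> y _; rewrite big_pred1_eq.
have cardW x : #|W x| = walks 2 x.
  by rewrite -sum1_card /= pair_big_dep /=; apply: eq_bigl => -[y z];
    rewrite inE.
have card_legs x :
    #|legs x| = walks 1 x ^ (m - #|F|) * walks 2 x ^ #|F|.
  rewrite card_family /image_mem foldrE big_map big_enum /=.
  rewrite (bigID (mem subdivided)) [RHS]mulnC; congr (_ * _).
    rewrite (eq_bigr (fun=> walks 2 x)) => [|i /= iS];
      last by rewrite iS; exact: cardW.
    by rewrite prod_nat_const card_subdivided.
  rewrite (eq_bigr (fun=> walks 1 x)) => [|i /= niS];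
    last by rewrite (negPf niS); exact: cardD.
  rewrite prod_nat_const -card_subdivided.
  have -> : m - #|subdivided| = #|~: subdivided|.
    by rewrite [RHS]cardsCs setCK card_ord.
  by congr expn; apply: eq_card => i; rewrite in_setC.
under eq_bigr do rewrite -card_legs -sum1_card.
rewrite pair_big_dep /= sum1_card.
pose mid (f : {ffun S -> G}) i :=
  if insub (star_edge i) is Some E then f (inr E) else f (inl (Some i)).
pose legs_of (f : {ffun S -> G}) : G * {ffun 'I_m -> G * G} :=
  (f (inl None), [ffun i => (mid f i, f (inl (Some i)))]).
have legs_of_inj : injective legs_of.
  move=> f g [eq_None /ffunP eq_legs]; apply/ffunP=> x.
  have eq_leg i : mid f i = mid g i /\ f (inl (Some i)) = g (inl (Some i)).
    by have := eq_legs i; rewrite !ffunE => -[-> ->].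
  have [->//|[i ->]|[i [iF ->]]] := subdivision_vertexP x.
    by case: (eq_leg i).
  by case: (eq_leg i); rewrite /mid insubT.
rewrite /Defs.hom -(card_imset _ legs_of_inj).
apply/subset_leq_card/subsetP => _ /imsetP[f + ->]; rewrite inE => hom_f.
have {}hom_f x y : @adj S x y -> adj (f x) (f y).
  by move: hom_f => /forallP/(_ x)/forallP/(_ y)/implyP.
apply/familyP => i; rewrite ffunE /mid inE.
case: insubP => [E iF def_E|niF].
  rewrite iF inE /= !hom_f //= def_E ?set21 ?set22 //.
rewrite (negPf niF) inE /= eqxx andbT hom_f //=.
Qed.

(** The tree is rooted at the centre [inl None], whose own parent is a dummy value. *)
Definition parent (x : S) : S :=
  if x is inl (Some i) then
    if insub (star_edge i) is Some E then inr E else inl None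
  else inl None.

Lemma adj_subdivision (x y : S) :
  adj x y =
    (x != inl None) && (y == parent x) || (y != inl None) && (x == parent y).
Proof.
have mem_mid i j : (Some i \in star_edge j) = (i == j) by rewrite !inE.
have adj_leaf_mid i (E : {E | E \in F}) :
    (Some i \in val E) = (inr E == parent (inl (Some i))).
  case: E => E EF /=; have := subsetP F_edges _ EF;
    rewrite edges_star => /imsetP[j _ def_E].
  subst E; rewrite mem_mid /parent; case: insubP => [E' _ def_E'|niF].
    by rewrite (inj_eq inr_inj) -[RHS](inj_eq val_inj)
      def_E' (inj_eq (@star_edge_inj m)) eq_sym.
  by apply/negP=> /eqP ij; rewrite ij EF in niF.
have adj_leaf_center i :
    (star_edge i \notin F) = (inl None == parent (inl (Some i))).
  by rewrite /parent; case: insubP => [E -> _|->].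
have mid_center (E : {E | E \in F}) : None \in val E.
  case: E => E EF /=; have := subsetP F_edges _ EF;
    rewrite edges_star => /imsetP[j _ ->].
  exact: set21.
have parent_leaf z i : (inl (Some i) == parent z) = false.
  by case: z => [[j|]|E] //=; case: insub.
case: x y => [[i|]|E] [[j|]|E']; rewrite ?parent_leaf ?andbF ?orbF //=;
  rewrite -?adj_leaf_mid -?adj_leaf_center ?mid_center //=.
by rewrite setUC.
Qed.

Lemma e_subdivision : e S = m + #|F|.
Proof.
have -> : m + #|F| = (v S).-1 by rewrite v_subdivision.
pose depth (x : S) :=
  match x with inl None => 0 | inl (Some _) => 2 | inr _ => 1 end.
apply: (@e_rooted_tree S (inl None) parent depth); last exact: adj_subdivision.
by case=> [[i|]|E] //= _; case: insub.
Qed.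

(** An end of a leg sees only its parent, a subdividing vertex sees two vertices, and the centre has
    at least [m] neighbours. For [m = 1] the centre would be a leaf as well. *)
Lemma num_leaves_subdivision : 1 < m -> num_leaves S = m.
Proof.
move=> m_gt1; rewrite /num_leaves.
have parent_leaf i z : (inl (Some i) == parent z) = false.
  by case: z => [[j|]|E] //=; case: insub.
pose leaf i : S := inl (Some i).
have leaf_inj : injective leaf by move=> i j [].
rewrite -[RHS](card_ord m) -(card_imset _ leaf_inj); apply: eq_card => x.
rewrite inE; apply/eqP/imsetP => [|[i _ ->]]; last first.
  rewrite /degree -(cards1 (parent (leaf i))); apply: eq_card => y.
  by rewrite !inE adj_subdivision parent_leaf andbF orbF.
have [->|[i ->]|[i [iF ->]]] := subdivision_vertexP x; last 2 first.
- by exists i.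
- have sub_nbrs : [set inl None; leaf i] \subset
      [set y | @adj S (inr (Sub (star_edge i) iF)) y].
    by apply/subsetP=> y; rewrite !inE => /orP[]/eqP->;
      rewrite /= ?set21 ?set22.
  by move=> deg1; have := subset_leq_card sub_nbrs;
    rewrite cards2 [X in _ <= X]deg1.
pose child i : S := if insub (star_edge i) is Some E then inr E else leaf i.
have child_inj : injective child.
  move=> i j; rewrite /child; case: insubP => [E _ def_E|_];
    case: insubP => [E' _ def_E'|_] //.
    by move=> [EE']; apply: star_edge_inj; rewrite -def_E -def_E' EE'.
  by case.
have sub_nbrs : [set child i | i in 'I_m] \subset [set y | @adj S (inl None) y].
  apply/subsetP=> _ /imsetP[i _ ->]; rewrite inE /child.
  by case: insubP => [E iF def_E|niF] //=; rewrite def_E set21.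
move=> deg1; have := subset_leq_card sub_nbrs;
  rewrite card_imset // card_ord [X in _ <= X]deg1.
by rewrite leqNgt m_gt1.
Qed.

End StarSubdivision.

(** * Walk counts through an equitable partition *)

Section Equitable.

Variables (G : sgraph) (q : nat) (c : G -> 'I_q) (D : 'I_q -> 'I_q -> nat).
Hypothesis card_nbrs : forall x j, #|[set y | adj x y & c y == j]| = D (c x) j.

Lemma sum_nbrs (f : 'I_q -> nat) x :
  \sum_(y | adj x y) f (c y) = \sum_j D (c x) j * f j.
Proof.
rewrite (partition_big c xpredT) //; apply: eq_bigr => j _.
rewrite -card_nbrs -sum_nat_const.
by apply: eq_big => y; rewrite ?inE // => /andP[_ /eqP ->].
Qed.

Lemma sum_colours (f : 'I_q -> nat) :
  \sum_x f (c x) = \sum_j #|[set x | c x == j]| * f j.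
Proof.
rewrite (partition_big c xpredT) //; apply: eq_bigr => j _.
rewrite -sum_nat_const.
by apply: eq_big => y; rewrite ?inE // => /eqP ->.
Qed.

(** The [i]-th entry of the [n]-th power of the quotient matrix [D] applied to the all-ones
    vector. *)
Fixpoint colour_walks n i :=
  if n is n'.+1 then \sum_j D i j * colour_walks n' j else 1.

Lemma walks_colour n x : walks n x = colour_walks n (c x).
Proof.
by elim: n x => //= n IH x; rewrite -sum_nbrs; apply: eq_bigr => y _; apply: IH.
Qed.

End Equitable.

(** * The witness graph, its degrees and class sizes *)

Section Witness.

Variables S T R B P : finType.

(* The classes A, B, C, D, in this order.  Vertices of consecutive classes are
   adjacent when their common coordinates agree, and D is complete with loops;
   [witness] is the bipartite double cover, which has the same degrees and no
   loops. *)
Definition vtx : finType :=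
  ((S * B * P) + (S * B) + (S * T * R) + (T * B))%type.

Definition vtx_colour (x : vtx) : 'I_4 :=
  match x with
  | inl (inl (inl _)) => inord 0
  | inl (inl (inr _)) => inord 1
  | inl (inr _) => inord 2
  | inr _ => inord 3
  end.

Definition vtx_adj : rel vtx := fun x y =>
  match x, y with
  | inl (inl (inl (s, b, _))), inl (inl (inr (s', b')))
  | inl (inl (inr (s, b))), inl (inl (inl (s', b', _))) =>
    (s == s') && (b == b')
  | inl (inl (inr (s, _))), inl (inr (s', _, _))
  | inl (inr (s, _, _)), inl (inl (inr (s', _))) => s == s'
  | inl (inr (_, t, _)), inr (t', _)
  | inr (t, _), inl (inr (_, t', _)) => t == t'
  | inr _, inr _ => true
  | _, _ => false
  end.

Definition witness_adj : rel (bool * vtx) :=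
  fun x y => (x.1 != y.1) && vtx_adj x.2 y.2.

Lemma witness_adj_sym : symmetric witness_adj.
Proof.
case=> [b x] [b' y]; rewrite /witness_adj eq_sym; congr (_ && _) => /=.
by case: x y => [[[[[s b1] p]|[s b1]]|[[s t] r]]|[t b1]]
  [[[[[s' b1'] p']|[s' b1']]|[[s' t'] r']]|[t' b1']] //=;
    rewrite ?(eq_sym s) ?(eq_sym t) ?(eq_sym b1).
Qed.

Lemma witness_adj_irrefl : irreflexive witness_adj.
Proof. by case=> b x; rewrite /witness_adj eqxx. Qed.

Definition witness := SGraph witness_adj_sym witness_adj_irrefl.

Definition witness_colour (x : witness) : 'I_4 := vtx_colour x.2.

(** Quotient matrix of the partition into A, B, C, D, with rows indexed by the class of the vertex
    whose neighbours are counted. *)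
Definition witness_degree (i j : 'I_4) : nat :=
  nth 0 (nth [::] [:: [:: 0; 1; 0; 0];
                      [:: #|P|; 0; #|T| * #|R|; 0];
                      [:: 0; #|B|; 0; #|B|];
                      [:: 0; 0; #|S| * #|R|; #|T| * #|B|]] i) j.

(** In the double cover all neighbours of [x] lie in the opposite layer, so a parametrisation [g] of
    the neighbours in [vtx] suffices. *)
Lemma card_witness_nbrs_image (U : finType) (g : U -> vtx) (x : witness) j :
    injective g ->
    (forall u, vtx_adj x.2 (g u) /\ vtx_colour (g u) = j) ->
    (forall y, vtx_adj x.2 y -> vtx_colour y = j -> exists u, y = g u) ->
  #|[set y | @adj witness x y & witness_colour y == j]| = #|U|.
Proof.
move=> g_inj g_nbr nbr_g; pose f u : witness := (~~ x.1, g u).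
have f_inj : injective f by move=> u u' [] /g_inj.
rewrite -(card_codom f_inj); apply: eq_card => -[b y];
  rewrite !inE /witness_adj /=.
apply/andP/codomP => [[/andP[xb xy] /eqP yj]|[u [-> ->]]].
  have [u ->] := nbr_g y xy yj; exists u.
  by rewrite /f; case: (x.1) (b) xb => [] [].
have [xu uj] := g_nbr u.
by rewrite /witness_adj /witness_colour /= xu uj eqxx andbT; case: (x.1).
Qed.

Lemma card_witness_nbrs x j :
  #|[set y | @adj witness x y & witness_colour y == j]| =
  witness_degree (witness_colour x) j.
Proof.
have colourE (a b : nat) :
    a < 4 -> b < 4 -> (inord a == inord b :> 'I_4) = (a == b).
  by move=> ? ?; rewrite -val_eqE /= !inordK.
have colour_neq (a b : nat) :
    a < 4 -> b < 4 -> a != b -> inord a = inord b :> 'I_4 -> False.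
  by move=> a4 b4 /eqP ab /(congr1 val) /=; rewrite !inordK.
have -> : j = inord j by rewrite inord_val.
have none_nbrs k : (forall y, vtx_adj x.2 y -> vtx_colour y <> k) ->
    #|[set y | @adj witness x y & witness_colour y == k]| = 0.
  move=> nadj; apply: eq_card0 => y; rewrite !inE;
    apply/negP => /andP[/andP[_ xy] /eqP].
  exact: nadj.
rewrite /witness_degree /witness_colour.
case: j => [[|[|[|[|//]]]] ?] /=;
case: x none_nbrs => b0 [[[[[s b] p]|[s b]]|[[s t] r]]|[t b]] none_nbrs /=;
  rewrite !inordK //=;
(* This removes the zero entries of the matrix. The seven others follow in the order BA, AB, CB, BC,
   DC, CD, DD. *)
try by apply: none_nbrs => -[[[[[? ?] ?]|[? ?]]|[[? ?] ?]]|[? ?]] //= _;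
  apply: colour_neq.
- apply: (@card_witness_nbrs_image P (fun p => inl (inl (inl (s, b, p)))))
    => /=.
  + by move=> p p' [].
  + by rewrite ?eqxx.
  case=> [[[[[s' b'] p']|[s' b']]|[[s' t'] r']]|[t' b']] //=;
    last by move=> _ /colour_neq[].
  by move=> /andP[/eqP <- /eqP <-] _; exists p'.
- rewrite -[RHS]card_unit;
    apply: (@card_witness_nbrs_image unit (fun=> inl (inl (inr (s, b))))) => /=.
  + by move=> [] [].
  + by rewrite ?eqxx.
  case=> [[[[[s' b'] p']|[s' b']]|[[s' t'] r']]|[t' b']] //=.
  by move=> /andP[/eqP <- /eqP <-] _; exists tt.
- apply: (@card_witness_nbrs_image B (fun b => inl (inl (inr (s, b))))) => /=.
  + by move=> p p' [].
  + by rewrite ?eqxx.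
  case=> [[[[[s' b'] p']|[s' b']]|[[s' t'] r']]|[t' b']] //=;
    last by move=> _ /colour_neq[].
  by move=> /eqP <- _; exists b'.
- rewrite -[RHS]card_prod;
    apply: (@card_witness_nbrs_image _ (fun u => inl (inr (s, u.1, u.2))))
      => /=.
  + by move=> [? ?] [? ?] [] /= -> ->.
  + by rewrite ?eqxx.
  case=> [[[[[s' b'] p']|[s' b']]|[[s' t'] r']]|[t' b']] //=;
    first by move=> _ /colour_neq[].
  by move=> /eqP <- _; exists (t', r').
- rewrite -[RHS]card_prod;
    apply: (@card_witness_nbrs_image _ (fun u => inl (inr (u.1, t, u.2))))
      => /=.
  + by move=> [? ?] [? ?] [] /= -> ->.
  + by rewrite ?eqxx.
  case=> [[[[[s' b'] p']|[s' b']]|[[s' t'] r']]|[t' b']] //=;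
    last by move=> _ /colour_neq[].
  by move=> /eqP <- _; exists (s', r').
- apply: (@card_witness_nbrs_image B (fun b => inr (t, b))) => /=.
  + by move=> p p' [].
  + by rewrite ?eqxx.
  case=> [[[[[s' b'] p']|[s' b']]|[[s' t'] r']]|[t' b']] //=;
    first by move=> _ /colour_neq[].
  by move=> /eqP <- _; exists b'.
rewrite -[RHS]card_prod;
  apply: (@card_witness_nbrs_image _ (fun u : T * B => inr u)) => //=.
  by move=> ? ? [].
case=> [[[[[s' b'] p']|[s' b']]|[[s' t'] r']]|[t' b']] //=;
  first by move=> _ /colour_neq[].
by exists (t', b').
Qed.

Lemma card_witness_colour (i : 'I_4) :
  #|[set x : witness | witness_colour x == i]| =
  2 * nth 0 [:: #|S| * #|B| * #|P|; #|S| * #|B|; #|S| * #|T| * #|R|;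
    #|T| * #|B|] i.
Proof.
have colourE (a b : nat) :
    a < 4 -> b < 4 -> (inord a == inord b :> 'I_4) = (a == b).
  by move=> ? ?; rewrite -val_eqE /= !inordK.
have -> : i = inord i by rewrite inord_val.
have -> : #|[set x : witness | witness_colour x == inord i]| =
    #|[set: bool]| * #|[set x : vtx | vtx_colour x == inord i]|.
  rewrite -cardsX; apply: eq_card => -[b x].
  by rewrite !inE.
rewrite cardsT card_bool; congr (_ * _).
rewrite -sum1dep_card big_mkcond /= !big_sumType /= !sum_nat_const !card_prod.
case: i => [[|[|[|[|//]]]] ?] /=;
  rewrite !colourE //= ?muln0 ?muln1 ?addn0 ?add0n.
all: by rewrite inordK.
Qed.

End Witness.

(** * Exponents of the walk count and of the star count *)

Section Counting.

Variables n M : nat.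
Hypothesis n_gt0 : 0 < n.
Hypothesis M_gt0 : 0 < M.

(** The sizes realise the prescribed exponents: [B] gives [r], [P] gives [p], [T * R] gives
    [p - r = 4 * M - 1], and [S * R] and [T * B] both give [u]. *)
Let S := 'I_(n ^ (2 * M ^ 2)).
Let T := 'I_(n ^ (2 * M - 1)).
Let R := 'I_(n ^ (2 * M)).
Let B := 'I_(n ^ (2 * M ^ 2 + 1)).
Let P := 'I_(n ^ (2 * M ^ 2 + 4 * M)).

Definition sparse_witness : sgraph := witness S T R B P.

Let D := witness_degree S T R B P.

(** Only the walks whose first step enters colour [j] are kept. *)
Lemma colour_walksS_ge (k a d : nat) (i j : 'I_4) :
  n ^ d <= D i j -> n ^ a <= colour_walks D k j ->
  n ^ (d + a) <= colour_walks D k.+1 i.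
Proof.
move=> le_d le_a; rewrite expnD /= (bigD1 j) //=.
by apply: leq_trans (leq_addr _ _); apply: leq_mul.
Qed.

Let oA : 'I_4 := inord 0.
Let oB : 'I_4 := inord 1.
Let oC : 'I_4 := inord 2.
Let oD : 'I_4 := inord 3.

Let DE :
  [/\ D oB oA = n ^ (2 * M ^ 2 + 4 * M), D oC oB = n ^ (2 * M ^ 2 + 1),
      D oD oC = n ^ (2 * M ^ 2 + 2 * M) & D oD oD = n ^ (2 * M ^ 2 + 2 * M)] /\
  [/\ D oA oB = n ^ 0, D oB oC = n ^ (4 * M - 1) &
      D oC oD = n ^ (2 * M ^ 2 + 1)].
Proof.
rewrite /D /witness_degree !inordK //= !card_ord -!expnD.
by split; split=> //; congr (_ ^ _); lia.
Qed.

Lemma sum_walks_witness_ge k :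
  n ^ ((k + 3) * (2 * M ^ 2 + 2 * M) + 2 * (2 * M ^ 2 + 1)
    + 2 * (2 * M ^ 2 + 4 * M)) <=
  \sum_(x : sparse_witness) walks (k + 6) x.
Proof.
have [[BA CB DC DD] [AB BC CD]] := DE.
(* The walk A B C D ... D C B A is built from its last step backwards: [B1], [C2] and [D3] cover the
   final descent, [Dk] adds [k] steps inside D, and three steps lead back to A. *)
have B1 : n ^ (2 * M ^ 2 + 4 * M + 0) <= colour_walks D 1 oB.
  by apply: (@colour_walksS_ge _ _ _ _ oA); rewrite ?BA.
have C2 := colour_walksS_ge (eq_leq (esym CB)) B1.
have D3 := colour_walksS_ge (eq_leq (esym DC)) C2.
set U := 2 * M ^ 2 + 2 * M in DC DD D3 *.
have Dk : n ^ (k * U + (U + (2 * M ^ 2 + 1 + (2 * M ^ 2 + 4 * M + 0)))) <=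
  colour_walks D (k + 3) oD.
  elim: k => [|k IH]; first by rewrite mul0n.
  by rewrite mulSn -addnA addSn; apply: colour_walksS_ge IH; rewrite DD.
have Ck := colour_walksS_ge (eq_leq (esym CD)) Dk.
have Bk := colour_walksS_ge (eq_leq (esym BC)) Ck.
have Ak := colour_walksS_ge (eq_leq (esym AB)) Bk.
rewrite (eq_bigr _ (fun x _ =>
  walks_colour (@card_witness_nbrs _ _ _ _ _) _ x)).
rewrite (sum_colours (@witness_colour _ _ _ _ _) (colour_walks D (k + 6))).
(* Only walks starting in A are kept; the factor 2 of the double cover is dropped below. *)
rewrite (bigD1 oA) //= card_witness_colour inordK //= !card_ord -!expnD.
apply: leq_trans (leq_addr _ _).
rewrite -mulnA; apply: leq_trans (leq_pmull _ (isT : 0 < 2)).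
rewrite (_ : k + 6 = (k + 3).+3); last by lia.
apply: leq_trans (leq_mul (leqnn _) Ak); rewrite -expnD.
apply: eq_leq; congr (_ ^ _); rewrite mulnDl; move: (k * U) => kU.
by rewrite /U; lia.
Qed.

(** Contribution of one class: [v] is its size, doubled by the cover, [x] its degree and [y] its
    number of 2-walks. The [m] factors each cost at most 4, and only the exponents of [n] remain to
    be compared. *)
Lemma star_term_le (v x y d w a E m s t : nat) :
    v <= 2 * n ^ a -> x <= 4 * n ^ d -> y <= 4 * n ^ w -> m = s + t ->
    a + t * d + s * w <= E ->
  v * (x ^ t * y ^ s) <= 2 * 4 ^ m * n ^ E.
Proof.
have le_exp k b c : b <= c -> b ^ k <= c ^ k.
  by case: k => // k le_bc; rewrite leq_exp2r.
move=> le_v le_x le_y -> le_E.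
apply: leq_trans (leq_mul le_v (leq_mul (le_exp t _ _ le_x)
  (le_exp s _ _ le_y))) _.
rewrite !expnMn -!expnM expnD.
rewrite (_ : _ * _ = 2 * (4 ^ s * 4 ^ t) * (n ^ a * n ^ (d * t)
  * n ^ (w * s))); last first.
  by rewrite !mulnA; lia.
rewrite -!expnD leq_mul // leq_pexp2l // (mulnC d) (mulnC w) //.
Qed.

(** The right side defining [E.+1] is the exponent in [sum_walks_witness_ge] for walks of length
    [M + 3 + s], so the star count loses at least one factor [n] up to a constant. *)
Lemma sum_star_witness_le s E :
    2 <= s <= M + 1 ->
    E.+1 = ((M + s) * (2 * M ^ 2 + 2 * M) + 2 * (2 * M ^ 2 + 1)
      + 2 * (2 * M ^ 2 + 4 * M)) ->
  \sum_(x : sparse_witness) walks 1 x ^ (M + 3 - s) * walks 2 x ^ s <=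
    8 * 4 ^ (M + 3) * n ^ E.
Proof.
move=> s_bounds def_E.
pose W k := colour_walks D k.
have -> : \sum_(x : sparse_witness) walks 1 x ^ (M + 3 - s) * walks 2 x ^ s =
    \sum_(x : sparse_witness) (fun i =>
      W 1 i ^ (M + 3 - s) * W 2 i ^ s) (witness_colour x).
  by apply: eq_bigr => x _;
    rewrite !(walks_colour (@card_witness_nbrs _ _ _ _ _)).
rewrite (sum_colours (@witness_colour _ _ _ _ _) (fun i =>
  W 1 i ^ (M + 3 - s) * W 2 i ^ s)).
have -> : 8 * 4 ^ (M + 3) * n ^ E = \sum_(i < 4) 2 * 4 ^ (M + 3) * n ^ E.
  by rewrite sum_nat_const card_ord !mulnA.
set p := 2 * M ^ 2 + 4 * M in def_E *.
set r := 2 * M ^ 2 + 1 in def_E *.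
set u := 2 * M ^ 2 + 2 * M in def_E *.
have W1 (i : 'I_4) : W 1 i =
    nth 0 [:: 1; n ^ p + n ^ (4 * M - 1); n ^ r + n ^ r; n ^ u + n ^ u] i.
  have -> : W 1 i = \sum_j D i j by apply: eq_bigr => j _; rewrite muln1.
  rewrite !big_ord_recl big_ord0 /D /witness_degree /= /bump /=
    !card_ord -!expnD.
  by case: i => [[|[|[|[|//]]]] ?] //=; rewrite ?add0n ?addn0 //;
    congr (_ + _); congr (_ ^ _); lia.
have W2 (i : 'I_4) : W 2 i =
    nth 0 [:: n ^ p + n ^ (4 * M - 1);
              n ^ p + n ^ (4 * M - 1) * (n ^ r + n ^ r);
              n ^ r * (n ^ p + n ^ (4 * M - 1)) + n ^ r * (n ^ u + n ^ u);
              n ^ u * (n ^ r + n ^ r) + n ^ u * (n ^ u + n ^ u)] i.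
  have -> : W 2 i = \sum_j D i j * W 1 j by [].
  rewrite !big_ord_recl big_ord0 !W1 /D /witness_degree /= /bump /=
    !card_ord -!expnD.
  case: i => [[|[|[|[|//]]]] ?] //=;
    rewrite ?mul0n ?mul1n ?muln1 ?add0n ?addn0 //.
    by congr (_ + _ ^ _ * _); lia.
  by congr (_ ^ _ * _ + _ ^ _ * _); lia.
(* These comparisons absorb the lower-order powers, leaving one leading power with coefficient at
   most 4; class C, with [n ^ r * (n ^ p + ...)], and class D need the full 4. *)
have le_n a b : a <= b -> n ^ a <= n ^ b by move=> ab; rewrite leq_pexp2l.
have le_qp : n ^ (4 * M - 1) <= n ^ p by apply: le_n; rewrite /p; lia.
have def_qr : n ^ (4 * M - 1) * n ^ r = n ^ p.
  by rewrite -expnD /p /r; congr (_ ^ _); lia.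
have le_up : n ^ u <= n ^ p by apply: le_n; rewrite /p /u; lia.
have le_ru : n ^ r <= n ^ u by apply: le_n; rewrite /r /u; lia.
have def_m : M + 3 = s + (M + 3 - s) by lia.
apply: leq_sum => i _; rewrite card_witness_colour W1 W2 !card_ord -!expnD.
case: i => [[|[|[|[|//]]]] ?] /=.
(* The four cases are A, B, C, D; the two explicit exponents are those of the degree and of the
   number of 2-walks. *)
- apply: (@star_term_le _ _ _ 0 p _ _ (M + 3) s (M + 3 - s) _ _ _ def_m).
  + exact: leqnn.
  + lia.
  + lia.
  move: def_E; rewrite /p /r /u; nia.
- apply: (@star_term_le _ _ _ p p _ _ (M + 3) s (M + 3 - s) _ _ _ def_m).
  + exact: leqnn.
  + lia.
  + lia.
  move: def_E; rewrite /p /r /u; nia.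
- apply: (@star_term_le _ _ _ r (r + p) _ _ (M + 3) s (M + 3 - s) _ _ _ def_m).
  + exact: leqnn.
  + lia.
  + by rewrite expnD; nia.
  move: def_E; rewrite /p /r /u; nia.
apply: (@star_term_le _ _ _ u (u + u) _ _ (M + 3) s (M + 3 - s) _ _ _ def_m).
- exact: leqnn.
- lia.
- by rewrite expnD; nia.
move: def_E; rewrite /p /r /u; nia.
Qed.

End Counting.

(** * From densities to homomorphism counts *)

Section Rationals.

Import Order.POrderTheory GRing.Theory Num.Theory.
Local Open Scope ring_scope.

(** Equal vertex numbers give equal denominators, and equal positive edge numbers give equal
    exponents, which cancel by monotonicity of powers. *)
Lemma dominates_hom_le (H T G : sgraph) :
    v H = v T -> e H = e T -> (0 < e H)%N -> (0 < v G)%N ->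
  dominates H T -> (Defs.hom T G <= Defs.hom H G)%N.
Proof.
move=> eq_v eq_e e_gt0 vG_gt0 /(_ G vG_gt0); rewrite -eq_e /Defs.t eq_v.
have vG_pos : 0 < (v G)%:R ^+ v T :> rat by rewrite exprn_gt0 // ltr0n.
rewrite ler_pXn2r // ?qualifE /= ?divr_ge0 ?ler0n ?(ltW vG_pos) //.
by rewrite ler_pM2r ?invr_gt0 // ler_nat.
Qed.

Lemma leaf_bounds_nat (k l : nat) :
    (k + 1)%:R / 2%:R <= l%:R :> rat -> l%:R <= k%:R - 3%:R :> rat ->
  (k + 1 <= 2 * l)%N /\ (l + 3 <= k)%N.
Proof.
by rewrite ler_pdivrMr // -natrM ler_nat mulnC lerBrDr -natrD ler_nat.
Qed.

End Rationals.

(** * Choice of parameters and contradiction between the two counts *)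

Theorem theorem1p8 (H : sgraph) (k l : nat)
    (H_near_star : near_star H) (H_vertices : v H = k)
    (H_leaves : num_leaves H = l)
    (l_lower : ((k + 1)%:R / 2%:R <= l%:R :> rat)%R)
    (l_upper : (l%:R <= k%:R - 3%:R :> rat)%R) :
  ~ dominates H (path_graph k).
Proof.
have [k_le l_le] := leaf_bounds_nat l_lower l_upper.
have [m [F [F_edges H_iso]]] := H_near_star.
have vH : k = (m + #|F|).+1 by rewrite -H_vertices (isomorphic_v H_iso)
  v_subdivision.
have F_le : #|F| <= m.
  by rewrite -[leqRHS](card_ord m) -(card_imset _ (@star_edge_inj m))
    -edges_star subset_leq_card.
(* The bounds on [l] force [l >= 4] and [k >= 7], so [F_le] gives [m >= 3]. This must precede the
   identification of [l] with [m]. *)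
have m_gt1 : 1 < m by lia.
have def_l : l = m by rewrite -H_leaves (isomorphic_num_leaves H_iso)
  num_leaves_subdivision.
have eH : e H = m + #|F| by rewrite (isomorphic_e H_iso) e_subdivision.
(* [n] exceeds the constant of the star bound by one, so a single extra factor [n] decides the
   comparison. *)
pose M := m - 3; pose n := (8 * 4 ^ m).+1.
pose G := sparse_witness n M.
pose E := ((M + #|F|) * (2 * M ^ 2 + 2 * M) + 2 * (2 * M ^ 2 + 1) +
           2 * (2 * M ^ 2 + 4 * M)).-1.
have M_gt0 : 0 < M by lia.
have def_E : E.+1 = ((M + #|F|) * (2 * M ^ 2 + 2 * M) + 2 * (2 * M ^ 2 + 1) +
  2 * (2 * M ^ 2 + 4 * M)) by rewrite prednK //; lia.
have hom_H : Defs.hom H G <= 8 * 4 ^ m * n ^ E.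
  apply: leq_trans (isomorphic_hom_le G H_iso) _.
  apply: leq_trans (hom_subdivision_le F_edges G) _.
  have M3 : M + 3 = m by lia.
  (* With [l = m], the two leaf bounds say exactly [2 <= #|F| <= M + 1]. *)
  have := @sum_star_witness_le n M isT M_gt0 #|F| E _ def_E; rewrite M3;
    apply; lia.
have walks_ge : n ^ E.+1 <= \sum_(x : G) walks (k - 1) x.
  (* No truncation occurs, since [M >= 1] and [#|F| >= 2]. *)
  have -> : k - 1 = (M + #|F| - 3) + 6 by lia.
  have := @sum_walks_witness_ge n M isT M_gt0 (M + #|F| - 3).
  by rewrite subnK -?def_E //; lia.
have hom_P : n ^ E.+1 <= Defs.hom (path_graph k) G.
  apply: leq_trans walks_ge _; rewrite {2}vH subn1 vH /=.
  exact: sum_walks_le_hom_path.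
have vG_gt0 : 0 < v G.
  rewrite lt0n; apply/negP => /eqP G0; move: walks_ge.
  by rewrite big1 ?leqn0 ?expn_eq0 // => x; have := fintype0 x G0.
have e_gt0 : 0 < e H by rewrite eH; lia.
have eq_v : v H = v (path_graph k) by rewrite /v card_ord.
have eq_e : e H = e (path_graph k) by rewrite eH vH e_path_graph.
move=> /(dominates_hom_le eq_v eq_e e_gt0 vG_gt0) le_hom.
have := leq_trans hom_P (leq_trans le_hom hom_H).
by rewrite expnS leq_pmul2r ?expn_gt0 // ltnn.
Qed.
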